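(* Let $R\to S$ be a perfectly finitely presented map of perfect $\mathbb F_p$-algebras, where $p$ is a prime. Then $S$ has finite projective dimension as an $R$-module: $\mathrm{p.dim}_R(S)<\infty$.
   Context: All rings are commutative. An $\mathbb F_p$-algebra is perfect if its Frobenius map $F: x\mapsto x^p$ is an isomorphism. The perfection of an $\mathbb F_p$-algebra $B$ is $\varinjlim(B\xrightarrow{F}B\xrightarrow{F}\cdots)$. A map $R\to S$ of perfect $\mathbb F_p$-algebras is perfectly finitely presented if $S$ is isomorphic, as an $R$-algebra, to the perfection of a finitely presented $R$-algebra $R[X_1,\dots,X_n]/(f_1,\dots,f_m)$. *)

(* Defs.v *)
From HB Require Import structures.
From mathcomp Require Import all_boot all_order all_algebra.
From mathcomp Require Import finmap monalg boolp.

Set Implicit Arguments.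
Unset Strict Implicit.
Unset Printing Implicit Defensive.

Import GRing.Theory.

Local Open Scope ring_scope.
Local Open Scope quotient_scope.

(* Rings are [comPzRingType]s, so that the zero ring is allowed.  MathComp's
   polynomial rings, ideal quotients and [pchar] all require 1 != 0, whence
   the constructions below. *)

(* [{malg R[{cmonom 'I_n}]}] is the additive group of finitely supported
   families of coefficients indexed by monomials in n variables; only its
   ring structure is restricted to 1 != 0 in the library. *)
Definition mvpoly (n : nat) (R : comPzRingType) : Type :=
  {malg R[{cmonom 'I_n}]}.

Section MvPoly.
Variables (n : nat) (R : comPzRingType).

HB.instance Definition _ := GRing.Zmodule.on (mvpoly n R).

Implicit Types (g : mvpoly n R) (k : {cmonom 'I_n}) (c : R).
Local Notation U c k := (mkmalgU k c : mvpoly n R).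

Definition mvpoly_one : mvpoly n R := mkmalgU mone 1.

Definition mvpoly_mul g1 g2 : mvpoly n R :=
  \sum_(k1 <- msupp g1) \sum_(k2 <- msupp g2)
    U (mcoeff k1 g1 * mcoeff k2 g2) (mmul k1 k2).

Let mulEw (d1 d2 : {fset {cmonom 'I_n}}) g1 g2 :
  (msupp g1 `<=` d1)%fset -> (msupp g2 `<=` d2)%fset ->
  mvpoly_mul g1 g2 = \sum_(k1 <- d1) \sum_(k2 <- d2)
    U (mcoeff k1 g1 * mcoeff k2 g2) (mmul k1 k2).
Proof.
move=> le_d1 le_d2; rewrite /mvpoly_mul (big_fset_incl _ le_d1) /=.
  apply/eq_bigr=> k1 _; apply/big_fset_incl => // k _ /mcoeff_outdom ->.
  by rewrite mulr0 monalgU0.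
move=> k _ /mcoeff_outdom g1k.
by rewrite big1 => // k' _; rewrite g1k mul0r monalgU0.
Qed.

Let mulC : commutative mvpoly_mul.
Proof.
move=> g1 g2; rewrite /mvpoly_mul exchange_big /=.
by apply/eq_bigr=> k1 _; apply/eq_bigr=> k2 _; rewrite mulrC mulmC.
Qed.

Let mulUU c1 c2 k1 k2 :
  mvpoly_mul (U c1 k1) (U c2 k2) = U (c1 * c2) (mmul k1 k2).
Proof. by rewrite (mulEw msuppU_le msuppU_le) !big_seq_fset1 !mcoeffUU. Qed.

Let mulDl : left_distributive mvpoly_mul +%R.
Proof.
move=> g1 g2 g.
rewrite [in RHS](mulEw (fsubsetUl _ (msupp g2)) (fsubset_refl _)).
rewrite [in RHS](mulEw (fsubsetUr (msupp g1) _) (fsubset_refl _)).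
rewrite (mulEw (msuppD_le _ _) (fsubset_refl _)).
rewrite -big_split /=; apply/eq_bigr=> k1 _.
rewrite -big_split /=; apply/eq_bigr=> k2 _.
by rewrite mcoeffD mulrDl monalgUD.
Qed.

Let mulDr : right_distributive mvpoly_mul +%R.
Proof. by move=> g g1 g2; rewrite mulC mulDl !(mulC g). Qed.

Let mul0 : left_zero 0 mvpoly_mul.
Proof. by move=> g; rewrite /mvpoly_mul msupp0 big_seq_fset0. Qed.

Let mul0' : right_zero 0 mvpoly_mul.
Proof. by move=> g; rewrite mulC mul0. Qed.

Let mul_suml I (r : seq I) (F : I -> mvpoly n R) g :
  mvpoly_mul (\sum_(i <- r) F i) g = \sum_(i <- r) mvpoly_mul (F i) g.
Proof.
exact: (big_morph (mvpoly_mul^~ g) (fun x y => mulDl x y g) (mul0 g)).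
Qed.

Let mul_sumr I (r : seq I) (F : I -> mvpoly n R) g :
  mvpoly_mul g (\sum_(i <- r) F i) = \sum_(i <- r) mvpoly_mul g (F i).
Proof. exact: (big_morph (mvpoly_mul g) (mulDr g) (mul0' g)). Qed.

Let mul1 : left_id mvpoly_one mvpoly_mul.
Proof.
move=> g; rewrite [in LHS](monalgE g) mul_sumr [RHS]monalgE.
by apply/eq_bigr=> k _; rewrite mulUU mul1r mul1m.
Qed.

Let mulA : associative mvpoly_mul.
Proof.
move=> g1 g2 g3.
move: mul_suml mul_sumr mulUU; move: mvpoly_mul => M Msl Msr MUU.
have ext3 a b : (forall c k, M a (M b (U c k)) = M (M a b) (U c k)) ->
    M a (M b g3) = M (M a b) g3.
  move=> abU; rewrite (monalgE g3) (Msr _ _ _ b) (Msr _ _ _ a).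
  by rewrite (Msr _ _ _ (M a b)); apply/eq_bigr.
have ext2 a : (forall c k, M a (M (U c k) g3) = M (M a (U c k)) g3) ->
    M a (M g2 g3) = M (M a g2) g3.
  move=> aU; rewrite (monalgE g2) (Msl _ _ _ g3) (Msr _ _ _ a).
  by rewrite (Msr _ _ _ a) (Msl _ _ _ g3); apply/eq_bigr.
rewrite (monalgE g1) (Msl _ _ _ (M g2 g3)) (Msl _ _ _ g2) (Msl _ _ _ g3).
apply/eq_bigr=> k1 _; move: (mcoeff k1 g1) => c1.
apply: ext2 => c2 k2; apply: ext3 => c3 k3.
apply: etrans (congr1 (M (U c1 k1)) (MUU c2 c3 k2 k3)) _.
apply: etrans _ (esym (congr1 (M^~ (U c3 k3)) (MUU c1 c2 k1 k2))).
apply: etrans (MUU _ _ _ _) _; apply: etrans _ (esym (MUU _ _ _ _)).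
by rewrite mulrA mulmA.
Qed.

HB.instance Definition _ := GRing.Zmodule_isComPzRing.Build (mvpoly n R)
  mulA mulC mul1 mulDl.

Definition mvpolyC (c : R) : mvpoly n R := U c mone.

Let mvpolyC_is_zmod_morphism : zmod_morphism mvpolyC.
Proof. by move=> a b; rewrite /mvpolyC monalgUB. Qed.

HB.instance Definition _ :=
  GRing.isZmodMorphism.Build R (mvpoly n R) mvpolyC mvpolyC_is_zmod_morphism.

Let mvpolyC_is_monoid_morphism : monoid_morphism mvpolyC.
Proof.
split=> [|a b]; first exact: erefl.
by apply: esym; apply: etrans (mulUU a b mone mone) _; rewrite mul1m.
Qed.

HB.instance Definition _ :=
  GRing.isMonoidMorphism.Build R (mvpoly n R) mvpolyC
    mvpolyC_is_monoid_morphism.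

Lemma mvpolyE g : g = \sum_(k <- msupp g) U (mcoeff k g) k.
Proof. exact: monalgE. Qed.

Lemma mvpoly_mulU c1 c2 k1 k2 : U c1 k1 * U c2 k2 = U (c1 * c2) (mmul k1 k2).
Proof. exact: mulUU. Qed.

End MvPoly.

Section IdealQuotient.
Variables (A : comPzRingType) (m : nat) (f : 'I_m -> A).

Definition in_ideal (x : A) : Prop :=
  exists c : 'I_m -> A, x = \sum_(i < m) c i * f i.

Let in_ideal0 : in_ideal 0.
Proof. by exists (fun=> 0); rewrite big1 // => i _; rewrite mul0r. Qed.

Let in_idealD x y : in_ideal x -> in_ideal y -> in_ideal (x + y).
Proof.
move=> [c ->] [d ->]; exists (fun i => c i + d i).
by rewrite -big_split; apply: eq_bigr => i _; rewrite mulrDl.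
Qed.

Let in_idealM a x : in_ideal x -> in_ideal (a * x).
Proof.
move=> [c ->]; exists (fun i => a * c i).
by rewrite mulr_sumr; apply: eq_bigr => i _; rewrite mulrA.
Qed.

Let in_idealN x : in_ideal x -> in_ideal (- x).
Proof. by rewrite -mulN1r; apply: in_idealM. Qed.

Definition ideal_equiv (x y : A) : bool := `[< in_ideal (x - y) >].

Let ideal_equiv_is_equiv : equiv_class_of ideal_equiv.
Proof.
split=> [x|x y|y x z]; first by apply/asboolP; rewrite subrr.
  by apply/asboolP/asboolP => /in_idealN; rewrite opprB.
move=> /asboolP xy /asboolP yz; apply/asboolP.
by rewrite -[x](subrK y) -addrA; apply: in_idealD.
Qed.

Canonical ideal_equiv_rel := EquivRelPack ideal_equiv_is_equiv.

Definition ideal_quot : Type := {eq_quot ideal_equiv}.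
HB.instance Definition _ : EqQuotient A ideal_equiv ideal_quot :=
  EqQuotient.on ideal_quot.
HB.instance Definition _ := Choice.on ideal_quot.

Definition ideal_proj (x : A) : ideal_quot := \pi_ideal_quot x.

Lemma ideal_projP x y : ideal_proj x = ideal_proj y <-> in_ideal (x - y).
Proof.
split=> [/eqP|h]; first by rewrite eqmodE => /asboolP.
by apply/eqP; rewrite eqmodE; apply/asboolP.
Qed.

Lemma ideal_proj_surj (z : ideal_quot) : exists x, z = ideal_proj x.
Proof. by exists (repr z); rewrite /ideal_proj reprK. Qed.

Let rK z : ideal_proj (repr z) = z. Proof. exact: reprK. Qed.

Definition quot_add (x y : ideal_quot) := ideal_proj (repr x + repr y).
Definition quot_opp (x : ideal_quot) := ideal_proj (- repr x).
Definition quot_mul (x y : ideal_quot) := ideal_proj (repr x * repr y).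

Let projD x y : quot_add (ideal_proj x) (ideal_proj y) = ideal_proj (x + y).
Proof.
apply/ideal_projP; rewrite opprD addrACA.
by apply: in_idealD; apply/ideal_projP; rewrite rK.
Qed.

Let projN x : quot_opp (ideal_proj x) = ideal_proj (- x).
Proof.
apply/ideal_projP; rewrite -opprD; apply: in_idealN.
by apply/ideal_projP; rewrite rK.
Qed.

Let projM x y : quot_mul (ideal_proj x) (ideal_proj y) = ideal_proj (x * y).
Proof.
apply/ideal_projP; set x' := repr _; set y' := repr _.
have -> : x' * y' - x * y = x' * (y' - y) + y * (x' - x).
  by rewrite !mulrBr addrA [y * x']mulrC [y * x]mulrC subrK.
by apply: in_idealD; apply: in_idealM; apply/ideal_projP; rewrite rK.
Qed.

Let addA : associative quot_add.
Proof. by move=> x y z; rewrite -[x]rK -[y]rK -[z]rK !projD addrA. Qed.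
Let addC : commutative quot_add.
Proof. by move=> x y; rewrite -[x]rK -[y]rK !projD addrC. Qed.
Let add0 : left_id (ideal_proj 0) quot_add.
Proof. by move=> x; rewrite -[x]rK projD add0r. Qed.
Let addN : left_inverse (ideal_proj 0) quot_opp quot_add.
Proof. by move=> x; rewrite -[x]rK projN projD addNr. Qed.

HB.instance Definition _ :=
  GRing.isZmodule.Build ideal_quot addA addC add0 addN.

Let mulA : associative quot_mul.
Proof. by move=> x y z; rewrite -[x]rK -[y]rK -[z]rK !projM mulrA. Qed.
Let mulC : commutative quot_mul.
Proof. by move=> x y; rewrite -[x]rK -[y]rK !projM mulrC. Qed.
Let mul1 : left_id (ideal_proj 1) quot_mul.
Proof. by move=> x; rewrite -[x]rK projM mul1r. Qed.
Let mulDl : left_distributive quot_mul +%R.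
Proof.
move=> x y z; rewrite -[x]rK -[y]rK -[z]rK.
by rewrite [_ + _]projD !projM [RHS]projD mulrDl.
Qed.

HB.instance Definition _ :=
  GRing.Zmodule_isComPzRing.Build ideal_quot mulA mulC mul1 mulDl.

Let ideal_proj_is_zmod_morphism : zmod_morphism ideal_proj.
Proof. by move=> x y; rewrite -projD -projN. Qed.
HB.instance Definition _ := GRing.isZmodMorphism.Build A ideal_quot ideal_proj
  ideal_proj_is_zmod_morphism.

Let ideal_proj_is_monoid_morphism : monoid_morphism ideal_proj.
Proof. by split=> // x y; rewrite -projM. Qed.
HB.instance Definition _ := GRing.isMonoidMorphism.Build A ideal_quot ideal_proj
  ideal_proj_is_monoid_morphism.

End IdealQuotient.

Section SeqColim.
Variables (B : comPzRingType) (F : {rmorphism B -> B}).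

(* The colimit of B -F-> B -F-> ...: (m, x) stands for the element x of the
   m-th copy of B. *)
Definition colim_equiv (u v : nat * B) : bool :=
  `[< exists i j, (u.1 + i = v.1 + j)%N /\ iter i F u.2 = iter j F v.2 >].

Let colim_equiv_is_equiv : equiv_class_of colim_equiv.
Proof.
split=> [u|u v|v u w]; first by apply/asboolP; exists 0%N, 0%N.
  by apply/asboolP/asboolP => -[i [j [e1 e2]]]; exists j, i.
move=> /asboolP[i [j [e1 e2]]] /asboolP[i' [j' [e1' e2']]]; apply/asboolP.
exists (i' + i)%N, (j + j')%N; rewrite !iterD e2 -e2' -!iterD.
by rewrite (addnC i') addnA e1 -addnA (addnC j) addnA e1' -addnA (addnC j') (addnC j).
Qed.

Canonical colim_equiv_rel := EquivRelPack colim_equiv_is_equiv.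

Definition seq_colim : Type := {eq_quot colim_equiv}.
HB.instance Definition _ : EqQuotient (nat * B)%type colim_equiv seq_colim :=
  EqQuotient.on seq_colim.
HB.instance Definition _ := Choice.on seq_colim.

Definition colim_in (m : nat) (x : B) : seq_colim := \pi_seq_colim (m, x).

Lemma colim_inP m x n y : colim_in m x = colim_in n y <->
  exists i j, (m + i = n + j)%N /\ iter i F x = iter j F y.
Proof.
split=> [/eqP|h]; first by rewrite eqmodE => /asboolP.
by apply/eqP; rewrite eqmodE; apply/asboolP.
Qed.

Lemma colim_in_iter k m x : colim_in (m + k) (iter k F x) = colim_in m x.
Proof. by apply/colim_inP; exists 0%N, k; rewrite addn0. Qed.

Lemma colim_in_surj (z : seq_colim) : exists m x, z = colim_in m x.
Proof. by exists (repr z).1, (repr z).2; rewrite /colim_in -surjective_pairing reprK. Qed.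

Let iter0 k : iter k F 0 = 0.
Proof. by elim: k => //= k ->; rewrite rmorph0. Qed.
Let iter1 k : iter k F 1 = 1.
Proof. by elim: k => //= k ->; rewrite rmorph1. Qed.
Let iterM k : {morph iter k F : x y / x * y}.
Proof. by move=> x y; elim: k => //= k ->; rewrite rmorphM. Qed.
Let iterA k : {morph iter k F : x y / x + y}.
Proof. by move=> x y; elim: k => //= k ->; rewrite rmorphD. Qed.
Let iterN k : {morph iter k F : x / - x}.
Proof. by move=> x; elim: k => //= k ->; rewrite rmorphN. Qed.

Let lift2 (op : B -> B -> B) (z w : seq_colim) : seq_colim :=
  let: (m, x) := repr z in let: (n, y) := repr w in
  colim_in (m + n) (op (iter n F x) (iter m F y)).

Let lift2E (op : B -> B -> B) :
  (forall k, {morph iter k F : x y / op x y}) ->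
  forall m x n y, lift2 op (colim_in m x) (colim_in n y) =
    colim_in (m + n) (op (iter n F x) (iter m F y)).
Proof.
move=> opF m x n y; rewrite /lift2.
case ez: (repr (colim_in m x)) => [m' x'].
case ew: (repr (colim_in n y)) => [n' y'].
have /colim_inP[i [j [e1 e2]]] : colim_in m' x' = colim_in m x.
  by rewrite /colim_in -ez reprK.
have /colim_inP[i' [j' [e1' e2']]] : colim_in n' y' = colim_in n y.
  by rewrite /colim_in -ew reprK.
apply/colim_inP; exists (i + i')%N, (j + j')%N; split.
  by rewrite addnACA e1 e1' addnACA.
rewrite !opF -!iterD; congr op.
  rewrite -addnA (addnC i') addnC iterD e2 e1' -iterD; congr iter.
  by rewrite -[RHS]addnA [RHS]addnC (addnC j').
rewrite addnAC (addnC i) iterD e2' e1 -iterD; congr iter.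
by rewrite [RHS]addnC addnA.
Qed.

Definition colim_add := lift2 +%R.
Definition colim_mul := lift2 *%R.
Definition colim_opp (z : seq_colim) : seq_colim :=
  colim_in (repr z).1 (- (repr z).2).

Let inD m x n y : colim_add (colim_in m x) (colim_in n y) =
  colim_in (m + n) (iter n F x + iter m F y).
Proof. exact: lift2E. Qed.

Let inM m x n y : colim_mul (colim_in m x) (colim_in n y) =
  colim_in (m + n) (iter n F x * iter m F y).
Proof. exact: lift2E. Qed.

Let inN m x : colim_opp (colim_in m x) = colim_in m (- x).
Proof.
rewrite /colim_opp; case ez: (repr _) => [m' x'] /=.
have /colim_inP[i [j [e1 e2]]] : colim_in m' x' = colim_in m x.
  by rewrite /colim_in -ez reprK.
by apply/colim_inP; exists i, j; rewrite !iterN e2.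
Qed.

Let common2 (z w : seq_colim) : exists m x y, z = colim_in m x /\ w = colim_in m y.
Proof.
have [m [x ->]] := colim_in_surj z; have [n [y ->]] := colim_in_surj w.
exists (m + n)%N, (iter n F x), (iter m F y).
by rewrite colim_in_iter addnC colim_in_iter.
Qed.

Let common3 (z w t : seq_colim) : exists m x y a,
  [/\ z = colim_in m x, w = colim_in m y & t = colim_in m a].
Proof.
have [m [x [y [-> ->]]]] := common2 z w; have [n [a ->]] := colim_in_surj t.
exists (m + n)%N, (iter n F x), (iter n F y), (iter m F a).
by rewrite !colim_in_iter addnC colim_in_iter.
Qed.

Let inD' m x y : colim_add (colim_in m x) (colim_in m y) = colim_in m (x + y).
Proof. by rewrite inD -iterA colim_in_iter. Qed.
Let inM' m x y : colim_mul (colim_in m x) (colim_in m y) = colim_in m (x * y).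
Proof. by rewrite inM -iterM colim_in_iter. Qed.
Let in0 m : colim_in m 0 = colim_in 0 0.
Proof. by rewrite -(colim_in_iter m 0) iter0. Qed.
Let in1 m : colim_in m 1 = colim_in 0 1.
Proof. by rewrite -(colim_in_iter m 0) iter1. Qed.

Let addA : associative colim_add.
Proof.
by move=> x y z; have [m [a [b [c [-> -> ->]]]]] := common3 x y z; rewrite !inD' addrA.
Qed.
Let addC : commutative colim_add.
Proof. by move=> x y; have [m [a [b [-> ->]]]] := common2 x y; rewrite !inD' addrC. Qed.
Let add0 : left_id (colim_in 0 0) colim_add.
Proof. by move=> x; have [m [a ->]] := colim_in_surj x; rewrite -(in0 m) inD' add0r. Qed.
Let addN : left_inverse (colim_in 0 0) colim_opp colim_add.
Proof. by move=> x; have [m [a ->]] := colim_in_surj x; rewrite inN inD' addNr in0. Qed.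

HB.instance Definition _ := GRing.isZmodule.Build seq_colim addA addC add0 addN.

Let mulA : associative colim_mul.
Proof.
by move=> x y z; have [m [a [b [c [-> -> ->]]]]] := common3 x y z; rewrite !inM' mulrA.
Qed.
Let mulC : commutative colim_mul.
Proof. by move=> x y; have [m [a [b [-> ->]]]] := common2 x y; rewrite !inM' mulrC. Qed.
Let mul1 : left_id (colim_in 0 1) colim_mul.
Proof. by move=> x; have [m [a ->]] := colim_in_surj x; rewrite -(in1 m) inM' mul1r. Qed.
Let mulDl : left_distributive colim_mul +%R.
Proof.
move=> x y z; have [m [a [b [c [-> -> ->]]]]] := common3 x y z.
by rewrite [_ + _]inD' !inM' [RHS]inD' mulrDl.
Qed.

HB.instance Definition _ :=
  GRing.Zmodule_isComPzRing.Build seq_colim mulA mulC mul1 mulDl.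

Let colim_in_is_zmod_morphism m : zmod_morphism (colim_in m).
Proof. by move=> x y; rewrite -inD' -inN. Qed.
HB.instance Definition _ m := GRing.isZmodMorphism.Build B seq_colim (colim_in m)
  (colim_in_is_zmod_morphism m).

Let colim_in_is_monoid_morphism m : monoid_morphism (colim_in m).
Proof. by split=> [|x y]; rewrite ?in1 // -inM'. Qed.
HB.instance Definition _ m := GRing.isMonoidMorphism.Build B seq_colim (colim_in m)
  (colim_in_is_monoid_morphism m).

End SeqColim.

(* Being an F_p-algebra is a property: the structure map, if it exists, is
   unique. *)
Definition Fp_algebra (p : nat) (B : comPzRingType) : Prop := p%:R = 0 :> B.

(* The proof arguments make the map canonically a ring morphism. *)
Definition frobenius (p : nat) (B : comPzRingType)
  (p_pr : prime p) (pB : Fp_algebra p B) (x : B) : B := x ^+ p.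

Section Frobenius.
Variables (p : nat) (B : comPzRingType).
Variables (p_pr : prime p) (pB : Fp_algebra p B).

Let frobenius_is_nmod_morphism : nmod_morphism (frobenius p_pr pB).
Proof.
split; first by rewrite /frobenius -(prednK (prime_gt0 p_pr)) exprS mul0r.
move=> x y; rewrite /frobenius exprDn; case: p p_pr pB => // q q_pr qB.
rewrite big_ord_recl big_ord_recr /= subn0 subnn !expr0 !mulr1 mul1r bin0 binn.
rewrite !mulr1n big1 ?add0r // => i _; rewrite -mulr_natr.
have /dvdnP[c ->] : (q.+1 %| 'C(q.+1, bump 0 i))%N.
  by rewrite prime_dvd_bin // /bump /= add1n ltnS ltn_ord.
by rewrite natrM qB !mulr0.
Qed.

HB.instance Definition _ := GRing.isNmodMorphism.Build B B
  (frobenius p_pr pB) frobenius_is_nmod_morphism.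

Let frobenius_is_monoid_morphism : monoid_morphism (frobenius p_pr pB).
Proof. by split=> [|x y]; rewrite /frobenius ?expr1n ?exprMn. Qed.

HB.instance Definition _ := GRing.isMonoidMorphism.Build B B
  (frobenius p_pr pB) frobenius_is_monoid_morphism.

Definition perfect : Prop := bijective (frobenius p_pr pB).

Definition perfection : comPzRingType := seq_colim (frobenius p_pr pB).

(* B acts on its perfection through the first copy of B. *)
Definition to_perfection : {rmorphism B -> perfection} :=
  colim_in (frobenius p_pr pB) 0.

End Frobenius.

Section FinPres.
Variables (R : comPzRingType) (n m : nat) (f : 'I_m -> mvpoly n R).

(* R[X_1, ..., X_n] / (f_1, ..., f_m) *)
Definition fp_alg : comPzRingType := ideal_quot f.

Definition fp_algC : {rmorphism R -> fp_alg} :=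
  (ideal_proj f \o @mvpolyC n R)%FUN.

Lemma fp_alg_Fp p : Fp_algebra p R -> Fp_algebra p fp_alg.
Proof. by rewrite /Fp_algebra -(rmorph_nat fp_algC) => ->; rewrite rmorph0. Qed.

End FinPres.

Definition perfectly_finitely_presented (p : nat) (p_pr : prime p)
    (R S : comPzRingType) (pR : Fp_algebra p R)
    (phi : {rmorphism R -> S}) : Prop :=
  exists (n m : nat) (f : 'I_m -> mvpoly n R)
    (h : {rmorphism perfection p_pr (fp_alg_Fp f pR) -> S}),
    bijective h /\
    forall a : R, h (to_perfection p_pr (fp_alg_Fp f pR) (fp_algC f a)) = phi a.

Definition res_scalars (R S : comPzRingType) (phi : {rmorphism R -> S}) : Type :=
  S.

Section ResScalars.
Variables (R S : comPzRingType) (phi : {rmorphism R -> S}).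

HB.instance Definition _ := GRing.Zmodule.on (res_scalars phi).

Definition res_scale (a : R) (x : res_scalars phi) : res_scalars phi :=
  phi a * (x : S).

Let res_scaleA a b x : res_scale a (res_scale b x) = res_scale (a * b) x.
Proof. by rewrite /res_scale mulrA rmorphM. Qed.
Let res_scale1 : left_id 1 res_scale.
Proof. by move=> x; rewrite /res_scale rmorph1 mul1r. Qed.
Let res_scaleDr : right_distributive res_scale +%R.
Proof. by move=> a x y; rewrite /res_scale [LHS]mulrDr. Qed.
Let res_scaleDl x : {morph res_scale^~ x : a b / a + b}.
Proof. by move=> a b; rewrite /res_scale rmorphD [LHS]mulrDl. Qed.

HB.instance Definition _ := GRing.Zmodule_isLmodule.Build R (res_scalars phi)
  res_scaleA res_scale1 res_scaleDr res_scaleDl.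

End ResScalars.

Definition surjective (X Y : Type) (g : X -> Y) : Prop :=
  forall y, exists x, g x = y.

Definition projective (R : pzRingType) (P : lmodType R) : Prop :=
  forall (M N : lmodType R) (g : {linear M -> N}) (u : {linear P -> N}),
    surjective g -> exists v : {linear P -> M}, forall x, g (v x) = u x.

(* M has a projective resolution
     0 -> P_d -> ... -> P_1 -> P_0 -> M -> 0. *)
Definition pdim_le (R : pzRingType) (M : lmodType R) (d : nat) : Prop :=
  exists (P : nat -> lmodType R)
         (del : forall i, {linear P i.+1 -> P i})
         (eps : {linear P 0%N -> M}),
    [/\ (forall i, projective (P i)),
        surjective eps,
        (forall x, eps x = 0 <-> exists y, del 0%N y = x),
        (forall i x, del i x = 0 <-> exists y, del i.+1 y = x) &
        (forall i, (d < i)%N -> forall x : P i, x = 0)].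

Definition finite_pdim (R : pzRingType) (M : lmodType R) : Prop :=
  exists d, pdim_le M d.

(* Main.v *)
Require Import Defs.
From HB Require Import structures.
From mathcomp Require Import all_boot all_order all_algebra.
From mathcomp Require Import finmap monalg boolp functions.

(** Let A be the perfection of R[X_1, ..., X_n].  Then S is the quotient of A by
    the ideal of all t some p-power of which lies in (f_1, ..., f_m), so S is
    reached from A in m steps, each passing from a perfect ring T to the
    quotient of T by I = (f^(1/p^oo)), the union of the ideals f^(1/p^k) T.
    Every such quotient is again perfect (it is the perfection of T/(f)).

    A is a free R-module on the monomials with nonnegative exponents in Z[1/p];
    this is where perfectness of R enters ([projective_mvpoly_perf]).

    A single step raises the projective dimension over R by at most 2
    ([has_pdim_perfect_quotient]).  Write r_k = f^(1/p^k) and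
    g_k = r_(k+1)^(p-1), so that r_k = g_k r_(k+1).  The ideal I is the colimit of
    T -g_0-> T -g_1-> T -> ..., the k-th copy of T mapping to I by r_k:
    if r_k x = 0, then (r_(k+1) x)^p = r_k x^p = 0, hence r_(k+1) x = 0 as T is
    reduced, hence g_k x = 0, so x already dies in the next copy.  The mapping
    telescope of this colimit is an exact sequence
      0 -> T^(oo) -> T^(oo) -> I -> 0,
    with T^(oo) the direct sum of countably many copies of T.  A direct sum of
    copies of T has the projective dimension of T ([has_pdim_dsum]), and a
    cokernel costs one more ([has_pdim_coker]); so I costs one, and T/I two.

    All projective dimensions are taken over R, also those of the intermediate
    rings, so the bounds for the m steps add up to pdim_R(S) <= 2m. *)

Set Implicit Arguments.
Unset Strict Implicit.
Unset Printing Implicit Defensive.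

Import GRing.Theory.

Local Open Scope ring_scope.

(** * Linear maps and kernels *)

Section Linear.
Variable R : pzRingType.
Implicit Types U V W : lmodType R.

(** Turns an explicitly given function into a bundled linear map without
    losing its formula. *)
Lemma linear_fun U V (f : U -> V) :
  linear f -> exists g : {linear U -> V}, g = f :> (U -> V).
Proof.
move=> lf; pose L := GRing.isLinear.Build R U V *:%R f lf.
pose g : {linear U -> V} := HB.pack f L.
by exists g.
Qed.

Lemma linear_corestrict U V W (j : {linear U -> V}) (f : {linear W -> V}) :
  injective j -> (forall w, exists u, j u = f w) ->
  exists g : {linear W -> U}, forall w, j (g w) = f w.
Proof.
move=> j_inj /choice[g gE].
have [|g' g'E] := @linear_fun W U g; last by exists g' => w; rewrite g'E gE.
by move=> a x y; apply: j_inj; rewrite linearP !gE linearP.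
Qed.

Variables (U V : lmodType R) (g : {linear U -> V}).

Definition kernel_pred : {pred U} := fun x => g x == 0.

Lemma kernel_pred_submod : submod_closed kernel_pred.
Proof.
split=> [|a x y]; rewrite !unfold_in ?linear0 //.
by move=> /eqP gx /eqP gy; rewrite linearP gx gy scaler0 addr0.
Qed.

HB.instance Definition _ := GRing.isSubmodClosed.Build R U kernel_pred kernel_pred_submod.

(** A type rather than a predicate, so that it can serve as the term of a
    resolution. *)
Definition kernel : Type := {x : U | x \in kernel_pred}.
HB.instance Definition _ := SubChoice.on kernel.
HB.instance Definition _ := [SubChoice_isSubLmodule of kernel by <:].

Definition kernel_val : {linear kernel -> U} := (val : kernel -> U).

Lemma kernel_valK (x : kernel) : g (kernel_val x) = 0.
Proof. by apply/eqP; apply: (valP x). Qed.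

Lemma kernel_val_inj : injective kernel_val. Proof. exact: val_inj. Qed.

Lemma kernel_valP (x : U) : g x = 0 -> exists y, kernel_val y = x.
Proof. by move/eqP=> gx; exists (Sub (x : U) (gx : x \in kernel_pred)). Qed.
End Linear.

(** * Projective dimension by dimension shifting *)

Section Pdim.
Variable R : pzRingType.
Implicit Types A B C K M N P : lmodType R.

Definition short_exact A B C (i : {linear A -> B}) (q : {linear B -> C}) : Prop :=
  [/\ injective i, surjective q & forall b, q b = 0 <-> exists a, i a = b].

(** Projective dimension at most n, by dimension shifting: some projective P
    surjects onto M with a kernel K of dimension at most n - 1.  Giving K only up
    to isomorphism, through a short exact sequence, makes the predicate visibly
    invariant. *)
Fixpoint has_pdim (n : nat) (M : lmodType R) : Prop :=
  if n is n'.+1 then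
    exists (K P : lmodType R) (i : {linear K -> P}) (q : {linear P -> M}),
      [/\ short_exact i q, projective P & has_pdim n' K]
  else projective M.

Lemma short_exact_kernel A B (g : {linear A -> B}) :
  surjective g -> short_exact (@kernel_val R A B g) g.
Proof.
move=> gs; split=> [||b]; [exact: kernel_val_inj|exact: gs|].
by split=> [/kernel_valP//|[y <-]]; apply: kernel_valK.
Qed.

Lemma projective_iso A B (f : {linear A -> B}) :
  bijective f -> projective A -> projective B.
Proof.
move=> f_bij A_proj M N g u g_surj.
have [f' f'E] : exists f' : {linear B -> A}, forall b, f (f' b) = idfun b.
  apply: linear_corestrict; first exact: bij_inj.
  by case: f_bij => h _ hK b; exists (h b); rewrite hK.
have [v vE] := A_proj M N g (u \o f)%FUN g_surj.
by exists (v \o f')%FUN => x; rewrite /= vE /= f'E.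
Qed.

Lemma has_pdim_iso n A B (f : {linear A -> B}) :
  bijective f -> has_pdim n A -> has_pdim n B.
Proof.
case: n => [|n]; [exact: projective_iso|move=> f_bij].
case=> K [P [i [q [[i_inj q_surj iq] P_proj Kn]]]].
exists K, P, i, (f \o q)%FUN; split=> //; split=> [//|b|b] /=.
  have [h _ hK] := f_bij.
  by have [x qx] := q_surj (h b); exists x; rewrite /= qx hK.
rewrite -iq -{1}(linear0 f); split=> [/(bij_inj f_bij)//|->//].
Qed.

Definition zero_mod : lmodType R := 'rV[R]_0.

Lemma zero_mod0 (x : zero_mod) : x = 0.
Proof. exact: thinmx0. Qed.

Lemma projective0 : projective zero_mod.
Proof. by move=> M N g u _; exists (\0 : {linear _ -> _}) => x; rewrite [x]zero_mod0 !linear0. Qed.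

Lemma has_pdimS n M : has_pdim n M -> has_pdim n.+1 M.
Proof.
elim: n M => [|n IH] M; last first.
  case=> K [P [i [q [iq P_proj Kn]]]].
  by exists K, P, i, q; split=> //; apply: IH.
move=> M_proj; exists zero_mod, M, (\0 : {linear _ -> _}), idfun; split=> //; last exact: projective0.
split=> [x y _|x|b]; [by rewrite (zero_mod0 x) (zero_mod0 y)|by exists x|].
by split=> [/= ->|[a <-]] //; exists 0.
Qed.

(** A splitting of q identifies B with the direct sum of A and C; [s] is the
    section and [r] the retraction. *)
Lemma projective_ext A B C (i : {linear A -> B}) (q : {linear B -> C}) :
  short_exact i q -> projective A -> projective C -> projective B.
Proof.
move=> [i_inj q_surj iq] A_proj C_proj M N g u g_surj.
have [s sE] := C_proj B C q idfun q_surj.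
have [r rE] : exists r : {linear B -> A},
    forall b, i (r b) = (idfun \- (s \o q)%FUN)%R b.
  apply: linear_corestrict => // b; apply/iq => /=.
  by rewrite linearB /= sE subrr.
have [a aE] := A_proj M N g (u \o i)%FUN g_surj.
have [c cE] := C_proj M N g (u \o s)%FUN g_surj.
exists ((a \o r) \+ (c \o q))%FUN => x /=.
by rewrite linearD aE cE /= rE /= -linearD subrK.
Qed.

Lemma projective_prod A C : projective A -> projective C -> projective (A * C)%type.
Proof.
have [|i iE] := @linear_fun R A (A * C)%type (fun a => (a, 0)).
  by move=> k x y; congr pair; rewrite /= scaler0 addr0.
have [|q qE] := @linear_fun R (A * C)%type C snd; first by [].
apply: (@projective_ext _ _ _ i q); split=> [x y|c|[a c]].
- by rewrite iE => -[].
- by exists (0, c); rewrite qE.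
- by rewrite qE iE; split=> /= [->|[a' []]//]; exists a.
Qed.

(** Horseshoe lemma: the presentations P_A -> A and P_C -> C combine, through a
    lift t of P_C -> C to B, into P_A x P_C -> B, and the kernels of the three
    maps again form a short exact sequence. *)
Lemma has_pdim_ext n A B C (i : {linear A -> B}) (q : {linear B -> C}) :
  short_exact i q -> has_pdim n A -> has_pdim n C -> has_pdim n B.
Proof.
elim: n A B C i q => [|n IH] A B C i q; first exact: projective_ext.
move=> [i_inj q_surj iq].
case=> KA [PA [iA [qA [[iA_inj qA_surj iqA] PA_proj KAn]]]].
case=> KC [PC [iC [qC [[iC_inj qC_surj iqC] PC_proj KCn]]]].
have [t tE] := PC_proj B C q qC q_surj.
pose G := ((i \o qA \o fst) \+ (t \o snd))%FUN : {linear (PA * PC)%type -> B}.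
have GE x y : G (x, y) = i (qA x) + t y by [].
have iq0 a : q (i a) = 0 by apply/iq; exists a.
have G_surj : surjective G.
  move=> b; have [y yE] := qC_surj (q b).
  have /iq[a aE] : q (b - t y) = 0 by rewrite linearB /= tE yE subrr.
  have [x xE] := qA_surj a.
  by exists (x, y); rewrite GE xE aE subrK.
exists (kernel G), (PA * PC)%type, (kernel_val G), G; split.
- exact: short_exact_kernel.
- exact: projective_prod.
have [j jE] : exists j : {linear KA -> kernel G}, forall k, kernel_val G (j k) = (iA k, 0).
  have [f fE] : exists f : {linear KA -> (PA * PC)%type},
      f = (fun k => (iA k, 0)) :> (_ -> _).
    by apply: linear_fun => k x y; rewrite linearP; congr pair; rewrite /= scaler0 addr0.
  have [|k|j jE] := @linear_corestrict _ _ _ _ (kernel_val G) f.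
  - exact: kernel_val_inj.
  - apply: kernel_valP; rewrite fE GE linear0 addr0.
    by have -> : qA (iA k) = 0 by [apply/iqA; exists k]; rewrite linear0.
  - by exists j => k; rewrite jE fE.
have [r rE] : exists r : {linear kernel G -> KC}, forall x, iC (r x) = (kernel_val G x).2.
  apply: (@linear_corestrict _ _ _ _ iC (snd \o kernel_val G)%FUN) => // x.
  apply/iqC; change (qC (kernel_val G x).2 = 0).
  have := kernel_valK x; case: (kernel_val G x) => a c; rewrite GE -tE.
  by move=> /(congr1 q); rewrite linearD iq0 add0r linear0.
apply: (IH _ _ _ j r _ KAn KCn); split=> [x y|c|x].
- by move/(congr1 (kernel_val G)); rewrite !jE => -[/iA_inj].
- have /iq[a aE] : q (t (iC c)) = 0 by rewrite tE; apply/iqC; exists c.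
  have [x xE] := qA_surj a.
  have [|z zE] := @kernel_valP _ _ _ G (- x, iC c).
    by rewrite GE !linearN xE aE addNr.
  by exists z; apply: iC_inj; rewrite rE zE.
- split=> [rx|[k <-]]; last by apply: iC_inj; rewrite rE jE linear0.
  have := rE x; have := kernel_valK x; rewrite rx linear0.
  case E: (kernel_val G x) => [a c]; rewrite GE => + /= c0; rewrite -c0.
  rewrite linear0 addr0 -(linear0 i) => /i_inj /iqA[k kE].
  by exists k; apply: (@kernel_val_inj _ _ _ G); rewrite jE kE E -c0.
Qed.

(** For n > 0 take a presentation P -> B with kernel K.  The kernel L of the
    composite P -> B -> C is the preimage of A in P, so it is an extension of A
    by K and the horseshoe lemma bounds its dimension. *)
Lemma has_pdim_coker n A B C (i : {linear A -> B}) (q : {linear B -> C}) :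
  short_exact i q -> has_pdim n A -> has_pdim n B -> has_pdim n.+1 C.
Proof.
case: n => [|n] iq_exact; first by exists A, B, i, q.
have [i_inj q_surj iq] := iq_exact.
move=> An [K [P [iB [qB [[iB_inj qB_surj iqB] P_proj Kn]]]]].
pose G := (q \o qB)%FUN : {linear P -> C}.
have G_surj : surjective G.
  by move=> c; have [b <-] := q_surj c; have [x <-] := qB_surj b; exists x.
exists (kernel G), P, (kernel_val G), G; split=> //; first exact: short_exact_kernel.
have [j jE] : exists j : {linear K -> kernel G}, forall k, kernel_val G (j k) = iB k.
  apply: linear_corestrict; first exact: kernel_val_inj.
  move=> k; apply: kernel_valP; rewrite /G /=.
  by have -> : qB (iB k) = 0 by [apply/iqB; exists k]; rewrite linear0.
have [r rE] : exists r : {linear kernel G -> A}, forall x, i (r x) = qB (kernel_val G x).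
  apply: (@linear_corestrict _ _ _ _ i (qB \o kernel_val G)%FUN) => // x.
  by apply/iq; apply: (kernel_valK x).
apply: (@has_pdim_ext _ _ _ _ j r _ (has_pdimS Kn) An); split=> [x y|a|x].
- by move/(congr1 (kernel_val G)); rewrite !jE => /iB_inj.
- have [x xE] := qB_surj (i a).
  have [|z zE] := @kernel_valP _ _ _ G x; first by rewrite /G /= xE; apply/iq; exists a.
  by exists z; apply: i_inj; rewrite rE zE.
- split=> [rx|[k <-]].
    have /iqB[k kE] : qB (kernel_val G x) = 0 by rewrite -(rE x) rx linear0.
    by exists k; apply: (@kernel_val_inj _ _ _ G); rewrite jE.
  by apply: i_inj; rewrite rE jE linear0; apply/iqB; exists k.
Qed.

(** Splices the successive short exact sequences into one resolution. *)
Lemma has_pdim_pdim_le n M : has_pdim n M -> pdim_le M n.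
Proof.
elim: n M => [|n IH] M.
  move=> M_proj; pose P i := if i is 0%N then M else zero_mod.
  pose del i : {linear P i.+1 -> P i} := \0.
  exists P, del, idfun; split=> [[|i]//||x|i x|[//|i] _ x].
  - exact: projective0.
  - by move=> x; exists x.
  - by split=> [/= ->|[y <-]] //; exists 0.
  - by split=> [_|//]; exists 0; rewrite [RHS]zero_mod0.
  - exact: zero_mod0.
case=> K [P0 [i0 [q0 [[i0_inj q0_surj iq0] P0_proj /IH]]]].
case=> P [del [eps [P_proj eps_surj eps_ex del_ex P_van]]].
pose P' i := if i is i'.+1 then P i' else P0.
pose del' i : {linear P' i.+1 -> P' i} :=
  match i return {linear P' i.+1 -> P' i} with
  | 0%N => (i0 \o eps)%FUN | i'.+1 => del i' end.
exists P', del', q0; split=> [[|i]|//|x|[|i] x|[//|i] lti x].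
- exact: P0_proj.
- exact: P_proj.
- rewrite iq0; split=> [[k <-]|[y <-]]; last by exists (eps y).
  by have [y <-] := eps_surj k; exists y.
- by rewrite /= -eps_ex; split=> [|->]; rewrite ?linear0 // -{1}(linear0 i0) => /i0_inj.
- exact: del_ex.
- exact: P_van.
Qed.

End Pdim.

(** * Countable direct sums *)

Definition vanishes_from (M : nmodType) (N : nat) (f : nat -> M) : Prop :=
  forall k, (N <= k)%N -> f k = 0.

Section DirectSum.
Variables (R : pzRingType) (M : lmodType R).

Definition fin_supp : {pred (nat -> M)} := fun f => `[< exists N, vanishes_from N f >].

Lemma fin_supp_submod : submod_closed fin_supp.
Proof.
split=> [|a f g]; rewrite !unfold_in; first by apply/asboolP; exists 0%N.
move=> /asboolP[Nf f0] /asboolP[Ng g0]; apply/asboolP.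
exists (maxn Nf Ng) => k; rewrite geq_max => /andP[fk gk].
by rewrite /= !fctE f0 // g0 // scaler0 addr0.
Qed.

HB.instance Definition _ :=
  GRing.isSubmodClosed.Build R (nat -> M) fin_supp fin_supp_submod.

Definition dsum : Type := {f : nat -> M | f \in fin_supp}.
HB.instance Definition _ := SubChoice.on dsum.
HB.instance Definition _ := [SubChoice_isSubLmodule of dsum by <:].

Definition coor (k : nat) (f : dsum) : M := (val f : nat -> M) k.

Lemma coor_linear k : linear (coor k).
Proof. by move=> a f g; rewrite /coor linearP. Qed.
HB.instance Definition _ k :=
  GRing.isLinear.Build R dsum M *:%R (coor k) (coor_linear k).

Lemma dsumP (f g : dsum) : (forall k, coor k f = coor k g) -> f = g.
Proof. by move=> fg; apply: val_inj; apply: funext. Qed.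

Lemma coor_vanishes (f : dsum) : exists N, vanishes_from N (fun k => coor k f).
Proof. exact/asboolP/(valP f). Qed.

Lemma dsum_of (f : nat -> M) N :
  vanishes_from N f -> exists g : dsum, forall k, coor k g = f k.
Proof.
move=> fN; have fP : f \in fin_supp by apply/asboolP; exists N.
by exists (Sub (f : nat -> M) fP).
Qed.

End DirectSum.

Section DirectSumUniversal.
Variables (R : pzRingType) (M N : lmodType R).

Lemma dsum_inj (k : nat) :
  exists g : {linear M -> dsum M}, forall x j, coor j (g x) = if j == k then x else 0.
Proof.
have /choice[g gE] : forall x : M, exists d : dsum M,
    forall j, coor j d = if j == k then x else 0.
  move=> x; apply: (@dsum_of _ _ _ k.+1) => j lt_kj.
  by rewrite gtn_eqF.
have [|g' g'E] := @linear_fun R M (dsum M) g; last by exists g' => x j; rewrite g'E gE.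
move=> a x y; apply: dsumP => j; rewrite linearP /= !gE.
by case: ifP; rewrite // scaler0 addr0.
Qed.

(** The universal property of the direct sum.  The value is stated for every
    bound K of the support, so that a common bound can be used for the terms of
    a sum. *)
Lemma dsum_lift (v : nat -> {linear M -> N}) :
  exists g : {linear dsum M -> N}, forall K (f : dsum M),
    vanishes_from K (fun k => coor k f) -> g f = \sum_(k < K) v k (coor k f).
Proof.
have ind (f : dsum M) K K' : vanishes_from K (fun k => coor k f) -> (K <= K')%N ->
    \sum_(k < K') v k (coor k f) = \sum_(k < K) v k (coor k f).
  move=> fK leK.
  have E n : \sum_(k < n) v k (coor k f) = \sum_(0 <= k < n) v k (coor k f).
    by rewrite big_mkord.
  rewrite !E (big_cat_nat _ leK) //= -[RHS]addr0; congr (_ + _).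
  by rewrite big_nat big1 // => k /andP[leKk _]; rewrite fK // linear0.
have /choice[g gE] : forall f : dsum M, exists y, forall K,
    vanishes_from K (fun k => coor k f) -> y = \sum_(k < K) v k (coor k f).
  move=> f; have [K fK] := coor_vanishes f.
  exists (\sum_(k < K) v k (coor k f)) => K' fK'.
  by case/orP: (leq_total K K') => leK; [rewrite (ind _ _ _ fK leK)|rewrite (ind _ _ _ fK' leK)].
have [|g' g'E] := @linear_fun R (dsum M) N g; last by exists g' => K f; rewrite g'E; apply: gE.
move=> a x y; have [K xK] := coor_vanishes x; have [K' yK] := coor_vanishes y.
have xK' : vanishes_from (maxn K K') (fun k => coor k x).
  by move=> k; rewrite geq_max => /andP[/xK].
have yK' : vanishes_from (maxn K K') (fun k => coor k y).
  by move=> k; rewrite geq_max => /andP[_ /yK].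
rewrite (gE _ _ xK') (gE _ _ yK') (gE _ (maxn K K')); last first.
  by move=> k lek; rewrite linearP /= xK' // yK' // scaler0 addr0.
rewrite scaler_sumr -big_split; apply: eq_bigr => k _ /=.
by rewrite !linearP.
Qed.

End DirectSumUniversal.

Section DirectSumPdim.
Variables (R : pzRingType).
Implicit Types (A B C M N P : lmodType R).

Lemma dsum_map A B (f : {linear A -> B}) :
  exists g : {linear dsum A -> dsum B}, forall x k, coor k (g x) = f (coor k x).
Proof.
have /choice[g gE] : forall x : dsum A, exists y : dsum B,
    forall k, coor k y = f (coor k x).
  move=> x; have [n xN] := coor_vanishes x.
  by apply: (@dsum_of _ _ _ n) => k lek; rewrite /= xN // linear0.
have [|g' g'E] := @linear_fun R (dsum A) (dsum B) g; last by exists g' => x k; rewrite g'E.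
by move=> a x y; apply: dsumP => k; rewrite [in RHS]linearP /= !gE !linearP.
Qed.

Lemma dsum_decomp M (f : dsum M) (K : nat) (i : nat -> {linear M -> dsum M}) :
  (forall k x j, coor j (i k x) = if j == k then x else 0) ->
  vanishes_from K (fun k => coor k f) -> f = \sum_(k < K) i k (coor k f).
Proof.
move=> iE fK; apply: dsumP => j; rewrite linear_sum /=.
under eq_bigr do rewrite iE.
rewrite -big_mkcond /=; have [ltjK|leKj] := ltnP j K.
  rewrite (bigD1 (Ordinal ltjK)) /= ?eqxx // big1 ?addr0 // => k /andP[/eqP jk /eqP[]].
  exact: val_inj.
rewrite big_pred0 ?fK // => k; apply/negbTE.
by rewrite gtn_eqF // (leq_trans (ltn_ord k)).
Qed.

Lemma projective_dsum P : projective P -> projective (dsum P).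
Proof.
move=> P_proj M N g u g_surj.
have [i iE] := choice (@dsum_inj R P).
have /choice[v vE] : forall k, exists v : {linear P -> M}, forall x, g (v x) = u (i k x).
  by move=> k; apply: (P_proj M N g (u \o i k)%FUN).
have [w wE] := dsum_lift v; exists w => f.
have [K fK] := coor_vanishes f.
rewrite (wE _ _ fK) [in RHS](dsum_decomp iE fK) !linear_sum.
by apply: eq_bigr => k _; rewrite vE.
Qed.

(** Preimages of the components can be chosen inside the support, which keeps
    them finitely supported. *)
Lemma short_exact_dsum A B C (i : {linear A -> B}) (q : {linear B -> C}) :
  short_exact i q -> exists (i' : {linear dsum A -> dsum B})
    (q' : {linear dsum B -> dsum C}), short_exact i' q'.
Proof.
move=> [i_inj q_surj iq].
have [i' iE] := dsum_map i; have [q' qE] := dsum_map q.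
exists i', q'; split=> [x y xy|c|b].
- by apply: dsumP => k; apply: i_inj; rewrite -!iE xy.
- have [n cN] := coor_vanishes c; have [s sE] := choice q_surj.
  have [|b bE] := @dsum_of R B (fun k => if (k < n)%N then s (coor k c) else 0) n.
    by move=> k leNk; rewrite ltnNge leNk.
  exists b; apply: dsumP => k; rewrite qE bE; case: ltnP => [_|leNk]; first exact: sE.
  by rewrite cN // linear0.
- split=> [qb0|[a <-]]; last first.
    by apply: dsumP => k; rewrite qE iE linear0; apply/iq; exists (coor k a).
  have /choice[a aE] : forall k, exists a, i a = coor k b.
    by move=> k; apply/iq; rewrite -qE qb0 linear0.
  have [n bN] := coor_vanishes b.
  have [|a' a'E] := @dsum_of R A a n.
    by move=> k leNk; apply: i_inj; rewrite aE linear0; apply: bN.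
  by exists a'; apply: dsumP => k; rewrite iE a'E aE.
Qed.

Lemma has_pdim_dsum n M : has_pdim n M -> has_pdim n (dsum M).
Proof.
elim: n M => [|n IH] M; first exact: projective_dsum.
case=> K [P [i [q [iq P_proj Kn]]]].
have [i' [q' iq']] := short_exact_dsum iq.
by exists (dsum K), (dsum P), i', q'; split; [| exact: projective_dsum | exact: IH].
Qed.

End DirectSumPdim.

(** * Powers and roots of exponent p^k *)

Section FrobeniusPowers.
Variables (p : nat) (p_pr : prime p).

Lemma Fp_algebra_rmorph (A B : comPzRingType) (f : {rmorphism A -> B}) :
  Fp_algebra p A -> Fp_algebra p B.
Proof. by rewrite /Fp_algebra -(rmorph_nat f) => ->; rewrite rmorph0. Qed.

Variables (B : comPzRingType) (pB : Fp_algebra p B).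
Local Notation F := (frobenius p_pr pB).

Lemma iter_frobenius k x : iter k F x = x ^+ (p ^ k).
Proof.
elim: k => [|k IH] /=; first by rewrite expr1.
by rewrite IH /frobenius -exprM mulnC expnS.
Qed.

Lemma exprp_rmorph k : exists f : {rmorphism B -> B}, forall x, f x = x ^+ (p ^ k).
Proof.
elim: k => [|k [f fE]]; first by exists idfun => x; rewrite expr1.
by exists (F \o f)%FUN => x /=; rewrite fE /frobenius -exprM mulnC expnS.
Qed.

Lemma exprp0 k : (0 : B) ^+ (p ^ k) = 0.
Proof. by have [f fE] := exprp_rmorph k; rewrite -fE rmorph0. Qed.

Lemma exprpB k (x y : B) : (x - y) ^+ (p ^ k) = x ^+ (p ^ k) - y ^+ (p ^ k).
Proof. by have [f fE] := exprp_rmorph k; rewrite -!fE rmorphB. Qed.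

Lemma exprpX k l (x : B) : x ^+ (p ^ (k + l)) = (x ^+ (p ^ k)) ^+ (p ^ l).
Proof. by rewrite expnD exprM. Qed.

Hypothesis B_perfect : perfect p_pr pB.

Lemma exprp_inj k : injective (fun x : B => x ^+ (p ^ k)).
Proof.
move=> x y; rewrite -!iter_frobenius; elim: k => //= k IH.
by move/(bij_inj B_perfect).
Qed.

Lemma exprp_eq0 k (x : B) : x ^+ (p ^ k) = 0 -> x = 0.
Proof. by move=> x0; apply: (@exprp_inj k); rewrite x0 exprp0. Qed.

Lemma proot_ex k (x : B) : exists y, y ^+ (p ^ k) = x.
Proof.
have [G _ GK] := B_perfect; exists (iter k G x); rewrite -iter_frobenius.
by elim: k => [|k IH] //; rewrite iterSr iterS GK.
Qed.

(** The unique root of exponent p^k of x; uniqueness ([exprp_inj]) makes it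
    additive and multiplicative in x. *)
Definition proot k (x : B) : B := projT1 (cid (proot_ex k x)).

Lemma prootK k x : proot k x ^+ (p ^ k) = x.
Proof. exact: projT2 (cid (proot_ex k x)). Qed.

Lemma exprpK k x : proot k (x ^+ (p ^ k)) = x.
Proof. by apply: (@exprp_inj k); rewrite prootK. Qed.

Lemma prootB k x y : proot k (x - y) = proot k x - proot k y.
Proof. by apply: (@exprp_inj k); rewrite exprpB !prootK. Qed.

Lemma prootM k x y : proot k (x * y) = proot k x * proot k y.
Proof. by apply: (@exprp_inj k); rewrite exprMn !prootK. Qed.

Lemma proot1 k : proot k 1 = 1.
Proof. by apply: (@exprp_inj k); rewrite prootK expr1n. Qed.

Lemma prootS k x : proot k.+1 (x ^+ p) = proot k x.
Proof.
apply: (@exprp_inj k.+1).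
by rewrite prootK expnSr exprM prootK.
Qed.

End FrobeniusPowers.

(** * The perfection of a ring *)

Section Colimit.
Variables (B : comPzRingType) (F : {rmorphism B -> B}).

(** The universal property of the colimit, for maps of sets: it is applied to
    ring maps and to module maps alike. *)
Lemma colim_lift (X : Type) (f : nat -> B -> X) :
  (forall m x, f m.+1 (F x) = f m x) ->
  exists g : seq_colim F -> X, forall m x, g (colim_in F m x) = f m x.
Proof.
move=> fF; have fF_iter k m x : f (m + k)%N (iter k F x) = f m x.
  by elim: k => [|k IH]; rewrite ?addn0 // addnS /= fF.
have /choice[g gE] : forall z : seq_colim F, exists y, forall m x,
    z = colim_in F m x -> y = f m x.
  move=> z; have [m [x ->]] := colim_in_surj z; exists (f m x) => m' x'.
  by case/colim_inP=> i [j [ij xx']]; rewrite -(fF_iter i) ij xx' fF_iter.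
by exists g => m x; rewrite (gE _ m x).
Qed.

Lemma colim_common (z w : seq_colim F) :
  exists m x y, z = colim_in F m x /\ w = colim_in F m y.
Proof.
have [m [x ->]] := colim_in_surj z; have [n [y ->]] := colim_in_surj w.
exists (m + n)%N, (iter n F x), (iter m F y).
by rewrite colim_in_iter addnC colim_in_iter.
Qed.

End Colimit.

Section Perfection.
Variables (p : nat) (p_pr : prime p) (B : comPzRingType) (pB : Fp_algebra p B).
Local Notation F := (frobenius p_pr pB).
Local Notation Bperf := (perfection p_pr pB).
Local Notation iota := (to_perfection p_pr pB).

Lemma Fp_perfection : Fp_algebra p Bperf.
Proof. exact: Fp_algebra_rmorph iota pB. Qed.

Lemma colim_in_exprp m x : (colim_in F m x : Bperf) ^+ (p ^ m) = iota x.
Proof.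
rewrite -(rmorphXn (colim_in F m)) -(iter_frobenius p_pr pB).
exact: (colim_in_iter F m 0 x).
Qed.

(** The inverse of Frobenius sends the element x of the m-th copy to the element
    x of the next copy. *)
Lemma perfect_perfection : perfect p_pr Fp_perfection.
Proof.
have Fin m x : frobenius p_pr Fp_perfection (colim_in F m x) = colim_in F m (F x).
  by rewrite /frobenius -(rmorphXn (colim_in F m)).
have [|g gE] := @colim_lift B F (seq_colim F) (fun m x => colim_in F m.+1 x).
  by move=> m x; rewrite -(colim_in_iter F 1 m.+1) addn1.
exists g => z; have [m [x ->]] := colim_in_surj z.
  by rewrite Fin gE -(colim_in_iter F 1 m) addn1.
by rewrite gE Fin -(colim_in_iter F 1 m) addn1.
Qed.

Lemma to_perfection_eq0 x : iota x = 0 <-> exists k, x ^+ (p ^ k) = 0.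
Proof.
rewrite -(rmorph0 iota); split=> [/colim_inP[i [j [ij]]]|[k xk]].
  by rewrite !iter_frobenius (exprp0 p_pr pB) => x0; exists i.
by apply/colim_inP; exists k, k; rewrite !iter_frobenius xk (exprp0 p_pr pB).
Qed.

(** The element x of the m-th copy stands for a p^m-th root of x, so it must go
    to the p^m-th root of f x. *)
Lemma perfection_lift (S : comPzRingType) (pS : Fp_algebra p S)
    (S_perfect : perfect p_pr pS) (f : {rmorphism B -> S}) :
  exists g : {rmorphism Bperf -> S}, forall x, g (iota x) = f x.
Proof.
have [|g gE] := @colim_lift B F S (fun m x => proot S_perfect m (f x)).
  by move=> m x; rewrite /frobenius rmorphXn prootS.
have gB : zmod_morphism (g : Bperf -> S).
  move=> z w; have [m [x [y [-> ->]]]] := colim_common z w.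
  by rewrite -(rmorphB (colim_in F m)) !gE rmorphB prootB.
have gM : monoid_morphism (g : Bperf -> S).
  split=> [|z w]; first by rewrite -(rmorph1 (colim_in F 0)) gE rmorph1 proot1.
  have [m [x [y [-> ->]]]] := colim_common z w.
  by rewrite -(rmorphM (colim_in F m)) !gE rmorphM prootM.
pose gz := GRing.isZmodMorphism.Build Bperf S g gB.
pose gm := GRing.isMonoidMorphism.Build Bperf S g gM.
pose g' : {rmorphism Bperf -> S} := HB.pack g gz gm.
by exists g' => x; rewrite /= gE; apply: (exprp_inj S_perfect (k := 0)); rewrite prootK.
Qed.

End Perfection.

(** * The perfection of a polynomial ring is projective *)

Section PolynomialPerfection.
Variables (p : nat) (p_pr : prime p) (R : comPzRingType) (pR : Fp_algebra p R).
Variable R_perfect : perfect p_pr pR.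
Variable n : nat.
Local Notation B := (mvpoly n R).
Local Notation U c k := (mkmalgU k c : B).

(** The coefficient maps [a k] are merely additive: below they are p-power roots,
    which are not R-linear. *)
Lemma mvpoly_lift (M : zmodType) (a : {cmonom 'I_n} -> R -> M) :
  (forall k, zmod_morphism (a k)) ->
  exists f : {additive B -> M}, forall c k, f (U c k) = a k c.
Proof.
move=> aB; have a0 k : a k 0 = 0 by rewrite -(subrr (0 : R)) aB subrr.
have aE (d : {fset {cmonom 'I_n}}) (x : B) : (msupp x `<=` d)%fset ->
    \sum_(k <- msupp x) a k (mcoeff k x) = \sum_(k <- d) a k (mcoeff k x).
  by move=> le_d; apply: big_fset_incl => // k _ /mcoeff_outdom ->.
pose f (x : B) := \sum_(k <- msupp x) a k (mcoeff k x).
have fB : zmod_morphism f.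
  move=> x y; pose d := (msupp x `|` msupp y)%fset.
  rewrite /f (aE d x) ?fsubsetUl // (aE d y) ?fsubsetUr //.
  rewrite (aE d) ?msuppB_le // -sumrB.
  by apply: eq_bigr => k _; rewrite mcoeffB aB.
pose fz := GRing.isZmodMorphism.Build B M f fB.
pose f' : {additive B -> M} := HB.pack f fz.
exists f' => c k; rewrite /= /f (aE [fset k]%fset) ?msuppU_le //.
by rewrite big_seq_fset1 mcoeffUU.
Qed.

Lemma mvpoly_additive_ext (M : zmodType) (f g : {additive B -> M}) :
  (forall c k, f (U c k) = g (U c k)) -> f =1 g.
Proof.
by move=> fg x; rewrite (mvpolyE x) !raddf_sum; apply: eq_bigr => k _; apply: fg.
Qed.

Lemma mvpolyC_mulU (b c : R) k : mvpolyC n b * U c k = U (b * c) k.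
Proof. by apply: etrans (mvpoly_mulU b c mone k) _; rewrite mul1m. Qed.

(** The monomial k' is e times k; it is the same for all coefficients c. *)
Lemma mvpolyU_exp e k : exists k', forall c, U c k ^+ e = U (c ^+ e) k'.
Proof.
elim: e => [|e [k' kE]]; first by exists mone.
by exists (mmul k k') => c; rewrite exprS kE mvpoly_mulU -exprS.
Qed.

Lemma Fp_mvpoly : Fp_algebra p B.
Proof. exact: Fp_algebra_rmorph (@mvpolyC n R) pR. Qed.

Local Notation F := (frobenius p_pr Fp_mvpoly).
Local Notation A := (perfection p_pr Fp_mvpoly).

Definition mvpoly_perfC : {rmorphism R -> A} :=
  (to_perfection p_pr Fp_mvpoly \o @mvpolyC n R)%FUN.

(** R acts through the 0-th copy, so its action on the m-th copy is twisted by
    the m-th power of Frobenius. *)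
Lemma mvpoly_perf_scale (a : R) m (x : B) :
  (a *: (colim_in F m x : res_scalars mvpoly_perfC) : res_scalars mvpoly_perfC)
  = colim_in F m (mvpolyC n (a ^+ (p ^ m)) * x).
Proof.
change (to_perfection p_pr Fp_mvpoly (mvpolyC n a) * colim_in F m x =
  colim_in F m (mvpolyC n (a ^+ (p ^ m)) * x)).
have -> : to_perfection p_pr Fp_mvpoly (mvpolyC n a) =
    colim_in F m (mvpolyC n (a ^+ (p ^ m))).
  rewrite (rmorphXn (@mvpolyC n R)) -(iter_frobenius p_pr Fp_mvpoly).
  by apply: esym; exact: (colim_in_iter F m 0).
by rewrite (rmorphM (colim_in F m)).
Qed.

(** Let e_(m,k) be the monomial X^k in the m-th copy, that is X^(k/p^m).  These
    span: sum_k c_k X^k in the m-th copy equals sum_k c_k^(1/p^m) e_(m,k).  A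
    lift of u along the surjection g is defined by the formula
      sum_k c_k X^k  |->  sum_k c_k^(1/p^m) s(u(e_(m,k))),
    where s is a set-theoretic section of g.  It passes to the colimit because
    e_(m,k) and e_(m+1,pk) are the same element of the perfection. *)
Lemma projective_mvpoly_perf : projective (res_scalars mvpoly_perfC).
Proof.
move=> M N g u g_surj; have [s sE] := choice g_surj.
pose rt m c := proot R_perfect m c.
have /choice[f fE] : forall m, exists f : {additive B -> M}, forall c k,
    f (U c k) = rt m c *: s (u (colim_in F m (U 1 k))).
  move=> m; apply: (@mvpoly_lift M (fun k c => rt m c *: s (u (colim_in F m (U 1 k))))).
  by move=> k a b; rewrite /rt prootB scalerBl.
have [|v vE] := @colim_lift B F M (fun m x => f m x).
  move=> m; apply: (@mvpoly_additive_ext M (f m.+1 \o F)%FUN (f m)) => c k /=.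
  have [k' kE] := mvpolyU_exp p k.
  have FU b : F (U b k) = U (b ^+ p) k' := kE b.
  have in_k : colim_in F m.+1 (U 1 k') = colim_in F m (U 1 k).
    have -> : U 1 k' = F (U 1 k) by rewrite FU expr1n.
    by have := colim_in_iter F 1 m (U 1 k); rewrite addn1.
  by rewrite FU (fE m.+1) (fE m) /rt (prootS R_perfect) in_k.
have [|v' v'E] := @linear_fun R (res_scalars mvpoly_perfC) M v.
  move=> a z w; have [m [x [y [-> ->]]]] := colim_common z w.
  rewrite mvpoly_perf_scale -(rmorphD (colim_in F m)) !vE raddfD; congr (_ + _).
  (* Both sides are additive in x, so they only need comparing on monomials. *)
  have [h hE] : exists h : {additive B -> B}, forall x, h x = mvpolyC n (a ^+ (p ^ m)) * x.
    by exists (mvpolyC n (a ^+ (p ^ m)) \*o idfun).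
  have [h' hE'] : exists h : {additive M -> M}, forall x, h x = a *: x.
    by exists (a \*: idfun).
  rewrite -hE -hE'.
  apply: (@mvpoly_additive_ext M (f m \o h)%FUN (h' \o f m)%FUN) => c k /=.
  rewrite hE hE' mvpolyC_mulU.
  apply: etrans (fE m _ k) _.
  apply: etrans _ (esym (congr1 (fun y => a *: y) (fE m c k))).
  by rewrite /rt (prootM R_perfect) (exprpK R_perfect) scalerA.
exists v' => z; rewrite v'E; have [m [x ->]] := colim_in_surj z.
rewrite vE.
apply: (@mvpoly_additive_ext N (g \o f m)%FUN (u \o colim_in F m)%FUN) => c k /=.
rewrite fE linearZ sE -linearZ; congr (u _).
by rewrite mvpoly_perf_scale mvpolyC_mulU mulr1 /rt prootK.
Qed.
End PolynomialPerfection.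

(** * Ring maps as maps of R-modules *)

Section Scalars.
Variable R : comPzRingType.

Lemma res_scalarsE (T : comPzRingType) (psi : {rmorphism R -> T}) a (x : res_scalars psi) :
  a *: x = psi a * (x : T).
Proof. by []. Qed.

Lemma res_scalars_linear (T S : comPzRingType) (psi : {rmorphism R -> T})
    (phi : {rmorphism R -> S}) (g : {rmorphism T -> S}) :
  (forall a, g (psi a) = phi a) ->
  exists h : {linear res_scalars psi -> res_scalars phi}, h = g :> (T -> S).
Proof.
move=> gE; apply: linear_fun => a x y.
by rewrite !res_scalarsE (rmorphD g) (rmorphM g) gE.
Qed.

Lemma res_scalars_mull (T : comPzRingType) (psi : {rmorphism R -> T}) (c : T) :
  exists h : {linear res_scalars psi -> res_scalars psi}, h = *%R c :> (T -> T).
Proof.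
apply: linear_fun => a x y; rewrite !res_scalarsE.
by change (c * (psi a * x + y) = psi a * (c * x) + c * y); rewrite mulrDr mulrCA.
Qed.

Lemma rmorph_factor (T T' S : comPzRingType) (rho : {rmorphism T -> T'})
    (g : {rmorphism T -> S}) :
  surjective rho -> (forall t, rho t = 0 -> g t = 0) ->
  exists g' : {rmorphism T' -> S}, forall t, g' (rho t) = g t.
Proof.
move=> rho_surj ker_rho; have [s sE] := choice rho_surj.
have gs t : g (s (rho t)) = g t.
  apply/eqP; rewrite -subr_eq0 -rmorphB; apply/eqP/ker_rho.
  by rewrite rmorphB sE subrr.
pose f := g \o s.
have fB : zmod_morphism f.
  by move=> x y; rewrite /f /= -{1}(sE x) -{1}(sE y) -rmorphB gs rmorphB.
have fM : monoid_morphism f.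
  split=> [|x y]; rewrite /f /=; first by rewrite -(rmorph1 rho) gs rmorph1.
  by rewrite -{1}(sE x) -{1}(sE y) -rmorphM gs rmorphM.
pose fz := GRing.isZmodMorphism.Build T' S f fB.
pose fm := GRing.isMonoidMorphism.Build T' S f fM.
pose g' : {rmorphism T' -> S} := HB.pack f fz fm.
by exists g' => t; rewrite /= /f /= gs.
Qed.
End Scalars.

(** * Killing all p-power roots of one element *)

Section Telescope.
Variables (p : nat) (p_pr : prime p) (R T T' : comPzRingType).
Variables (pT : Fp_algebra p T) (T_perfect : perfect p_pr pT).
Variables (psi : {rmorphism R -> T}) (psi' : {rmorphism R -> T'}).
Variables (f : T) (rho : {rmorphism T -> T'}).
Hypothesis rho_psi : forall a, rho (psi a) = psi' a.
Hypothesis rho_surj : surjective rho.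
Hypothesis rho_ker : forall t, rho t = 0 <-> exists k c, t ^+ (p ^ k) = c * f.

Local Notation M := (res_scalars psi).
Local Notation r := (fun k => proot T_perfect k f).
Local Notation g := (fun k => proot T_perfect k.+1 f ^+ p.-1).

Lemma prootX k : r k.+1 ^+ p = r k.
Proof.
by apply: (exprp_inj T_perfect (k := k)); rewrite -exprM -expnS !prootK.
Qed.

Lemma proot_step k : r k = g k * r k.+1.
Proof. by rewrite -exprSr prednK ?prime_gt0 // prootX. Qed.

(** Reducedness of T makes (r_(k+1) x)^p = (r_k x) x^(p-1) = 0 kill r_(k+1) x,
    and g_k is a multiple of r_(k+1) because p - 1 > 0. *)
Lemma mul_proot_eq0 k (x : T) : r k * x = 0 -> g k * x = 0.
Proof.
move=> rx0; have rx0' : r k.+1 * x = 0.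
  apply: (exprp_eq0 T_perfect (k := 1)); rewrite expn1 exprMn prootX.
  have -> : x ^+ p = x * x ^+ p.-1 by rewrite -exprS prednK ?prime_gt0.
  by rewrite mulrA rx0 mul0r.
have [q ->] : exists q, p.-1 = q.+1.
  by exists p.-2; case: (p) p_pr => [|[|q]].
by rewrite exprSr -mulrA rx0' mulr0.
Qed.

(** The first k + 1 columns of the telescope push v into the k-th copy of T,
    where the sum becomes w_k. *)
Lemma telescope_sum (v w : nat -> T) k :
  w 0%N = v 0%N -> (forall j, w j.+1 = v j.+1 + g j * w j) ->
  \sum_(i < k.+1) r i * v i = r k * w k.
Proof.
move=> w0 wS; elim: k => [|k IH]; first by rewrite big_ord1 w0.
by rewrite big_ord_recr /= IH proot_step wS mulrDr [RHS]addrC -mulrA mulrCA.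
Qed.

Let subM0 (a b c : T) : a = 0 -> b = 0 -> a - c * b = 0.
Proof. by move=> -> ->; rewrite mulr0 subr0. Qed.

Lemma telescope_diff : exists D : {linear dsum M -> dsum M}, forall x,
  (coor 0 (D x) = coor 0 x) /\
  (forall k, coor k.+1 (D x) = (coor k.+1 x : T) - g k * (coor k x : T)).
Proof.
have /choice[D DE] : forall x : dsum M, exists y : dsum M, forall k,
    coor k y = if k is j.+1 then (coor j.+1 x : T) - g j * (coor j x : T) else coor 0 x.
  move=> x; have [N xN] := coor_vanishes x.
  apply: (@dsum_of R M _ N.+1) => -[//|k] ltNk.
  by apply: subM0; apply: xN => //; apply: ltnW.
have [|D' D'E] := @linear_fun R (dsum M) (dsum M) D.
  move=> a x y; apply: dsumP => k; rewrite [in RHS]linearP /= !DE.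
  case: k => [|k]; first by rewrite linearP.
  rewrite !linearP /= !res_scalarsE.
  move: (coor k x) (coor k y) (coor k.+1 x) (coor k.+1 y) => /= x1 y1 x2 y2.
  change (psi a * x2 + y2 - g k * (psi a * x1 + y1) =
    psi a * (x2 - g k * x1) + (y2 - g k * y1)).
  by rewrite mulrBr mulrDr (mulrCA (g k)) opprD addrACA.
by exists D' => x; rewrite D'E; split=> [|k]; rewrite DE.
Qed.

Lemma telescope_aug : exists e : {linear dsum M -> M}, forall K (x : dsum M),
  vanishes_from K (fun k => coor k x) -> e x = \sum_(k < K) r k * (coor k x : T).
Proof.
have /choice[v vE] : forall k, exists h : {linear M -> M}, h = *%R (r k) :> (T -> T).
  by move=> k; apply: res_scalars_mull.
have [e eE] := dsum_lift v; exists e => K x /eE ->.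
by apply: eq_bigr => k _; rewrite vE.
Qed.

(** The telescope resolves the kernel of rho, which consists of the multiples of
    the r_k: t^(p^k) = c f means t = c^(1/p^k) r_k. *)
Lemma has_pdim_perfect_quotient n :
  has_pdim n M -> has_pdim n.+2 (res_scalars psi').
Proof.
move=> Mn; have [pi piE] := res_scalars_linear rho_psi.
have [D /all_and2[D0 DS]] := telescope_diff; have [e eE] := telescope_aug.
have pi0 x : pi x = 0 <-> exists k c, (x : T) ^+ (p ^ k) = c * f by rewrite piE.
have pi_e x : pi (e x) = 0.
  have [K xK] := coor_vanishes x; rewrite (eE _ _ xK) piE.
  rewrite (rmorph_sum rho) big1 // => k _; rewrite rmorphM.
  by have -> : rho (r k) = 0; [apply/rho_ker; exists k, 1; rewrite prootK mul1r|exact: mul0r].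
have [e' e'E] : exists e' : {linear dsum M -> kernel pi}, forall x, kernel_val pi (e' x) = e x.
  apply: linear_corestrict => [|x]; first exact: kernel_val_inj.
  by have [y yE] := kernel_valP (pi_e x); exists y.
have De x y : y = D x -> e y = 0.
  move=> ->; have [K xK] := coor_vanishes x.
  have DK : vanishes_from K.+1 (fun k => coor k (D x)).
    move=> [//|k] ltKk; rewrite DS.
    by apply: subM0; apply: xK => //; apply: ltnW.
  rewrite (eE _ _ DK).
  rewrite (telescope_sum (v := fun k => coor k (D x)) (w := fun k => coor k x)).
  - by rewrite xK //; apply: mulr0.
  - by rewrite D0.
  - by move=> j; rewrite DS; apply: esym; apply: subrK.
have D_exact x : e x = 0 -> exists y, D y = x.
  move=> ex0; have [K xK] := coor_vanishes x.
  (* The only sequence with D w = x; what has to be seen is that it vanishes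
     eventually. *)
  pose w := fix w k : T := if k is j.+1 then (coor j.+1 x : T) + g j * w j else coor 0 x.
  have wK k : (K < k)%N -> w k = 0.
    have wS j : (K <= j)%N -> g j * w j = 0 -> w j.+1 = 0.
      by move=> leKj gw0; rewrite /= gw0 (xK j.+1) ?(leq_trans leKj) // addr0.
    elim: k => // k IH; rewrite ltnS leq_eqVlt => /orP[/eqP <-|ltKk]; last first.
      by apply: wS; [exact: ltnW|rewrite IH // mulr0].
    (* r_K w_K is the whole sum e x = 0, hence g_K w_K = 0. *)
    apply: wS => //; apply: mul_proot_eq0.
    rewrite -(telescope_sum (v := fun k => coor k x)) // -(eE K.+1 x) //.
    by move=> k' ltKk'; apply: xK; apply: ltnW.
  have [|y yE] := @dsum_of R M w K.+1; first by move=> k; apply: wK.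
  exists y; apply: dsumP => -[|k]; first by rewrite D0 yE.
  by rewrite DS !yE /= addrK.
have De_exact : short_exact D e'.
  split=> [x y xy|z|x].
  - apply: dsumP; elim=> [|k IH]; first by rewrite -(D0 x) -(D0 y) xy.
    by have := DS x k; rewrite xy DS IH => /(@addIr T _) ->.
  - have /pi0[k [c zE]] := kernel_valK z.
    have [i iE] := @dsum_inj R M k.
    exists (i (proot T_perfect k c)); apply: (@kernel_val_inj _ _ _ pi); rewrite e'E.
    rewrite (eE k.+1); last by move=> j ltkj; rewrite iE gtn_eqF.
    rewrite big_ord_recr /= big1 => [|j _]; last first.
      by rewrite iE ltn_eqF //; apply: mulr0.
    rewrite iE eqxx add0r; apply: (exprp_inj T_perfect (k := k)).
    by rewrite exprMn !prootK mulrC zE.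
  - split=> [e'x0|[y yx]]; first by apply: D_exact; rewrite -e'E e'x0 linear0.
    by apply: (@kernel_val_inj _ _ _ pi); rewrite e'E linear0; apply: De (esym yx).
have Dn := has_pdim_dsum Mn.
apply: has_pdim_coker (short_exact_kernel _) (has_pdim_coker De_exact Dn Dn) (has_pdimS Mn).
by move=> y; have [x <-] := rho_surj y; exists x; rewrite piE.
Qed.
End Telescope.

(** * Killing the roots of finitely many elements *)

Section PerfectedQuotients.
Variables (p : nat) (p_pr : prime p).

(** The perfection of T/(f).  It is a quotient of T because T is perfect. *)
Lemma perfected_quotient (T : comPzRingType) (pT : Fp_algebra p T)
    (T_perfect : perfect p_pr pT) (f : T) :
  exists (T' : comPzRingType) (pT' : Fp_algebra p T') (rho : {rmorphism T -> T'}),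
  [/\ perfect p_pr pT', surjective rho &
      forall t, rho t = 0 <-> exists k c, t ^+ (p ^ k) = c * f].
Proof.
pose q : {rmorphism T -> ideal_quot (fun _ : 'I_1 => f)} := ideal_proj (fun _ : 'I_1 => f).
have pQ := Fp_algebra_rmorph q pT.
pose iota : {rmorphism _ -> perfection p_pr pQ} := to_perfection p_pr pQ.
have q0 t : q t = 0 <-> exists c, t = c * f.
  rewrite -(rmorph0 q); split=> [/ideal_projP[c]|[c ->]].
    by rewrite subr0 big_ord1 => ->; exists (c ord0).
  by apply/ideal_projP; exists (fun=> c); rewrite subr0 big_ord1.
have PT' := perfect_perfection p_pr pQ.
exists (perfection p_pr pQ), (Fp_perfection p_pr pQ), (iota \o q)%FUN; split=> //.
- move=> z; have [m [x ->]] := colim_in_surj z; have [t ->] := ideal_proj_surj x.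
  exists (proot T_perfect m t); apply: (exprp_inj PT' (k := m)).
  rewrite /= -rmorphXn -rmorphXn prootK; apply: esym; exact: colim_in_exprp.
- move=> t /=; split.
    by move=> /to_perfection_eq0[k]; rewrite -rmorphXn => /q0 ?; exists k.
  case=> k tk; apply/to_perfection_eq0; exists k; rewrite -rmorphXn; exact/q0.
Qed.

(** Induction on the number of equations: the quotient T' of T by the roots of
    f_0 is perfect, and g factors through it as S is reduced.  The hypotheses
    say that the kernel of g is the radical of (f_0, ..., f_(m-1)). *)
Lemma has_pdim_perfected_quotients m (R T S : comPzRingType)
    (pT : Fp_algebra p T) (T_perfect : perfect p_pr pT)
    (pS : Fp_algebra p S) (S_perfect : perfect p_pr pS)
    (psi : {rmorphism R -> T}) (phi : {rmorphism R -> S})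
    (f : 'I_m -> T) (g : {rmorphism T -> S}) n :
  (forall a, g (psi a) = phi a) -> surjective g ->
  (forall i, g (f i) = 0) ->
  (forall t, g t = 0 -> exists k, in_ideal f (t ^+ (p ^ k))) ->
  has_pdim n (res_scalars psi) -> has_pdim (n + m.*2) (res_scalars phi).
Proof.
elim: m T pT T_perfect psi f g n => [|m IH] T pT T_perfect psi f g n g_psi g_surj gf g_ker Tn.
  have [h hE] := res_scalars_linear g_psi.
  rewrite addn0; apply: (@has_pdim_iso _ _ _ _ h) Tn; rewrite hE.
  have g_inj : injective g.
    move=> x y xy; apply/eqP; rewrite -subr_eq0; apply/eqP.
    have /g_ker[k [c]] : g (x - y) = 0 by rewrite rmorphB xy subrr.
    by rewrite big_ord0 => /(exprp_eq0 T_perfect).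
  by have [s sE] := choice g_surj; exists s => x //; apply: g_inj; rewrite sE.
have [T' [pT' [rho [T'_perfect rho_surj rho_ker]]]] := perfected_quotient T_perfect (f ord0).
have [|g' g'E] := @rmorph_factor T T' S rho g rho_surj.
  move=> t /rho_ker[k [c tk]]; apply: (exprp_eq0 S_perfect (k := k)).
  by rewrite -rmorphXn tk rmorphM gf mulr0.
have T'n := @has_pdim_perfect_quotient p p_pr R T T' pT T_perfect psi (rho \o psi)%FUN
  (f ord0) rho (fun=> erefl) rho_surj rho_ker n Tn.
have -> : (n + m.+1.*2 = n.+2 + m.*2)%N by rewrite doubleS !addnS !addSn.
apply: (IH T' pT' T'_perfect (rho \o psi)%FUN (fun i => rho (f (lift ord0 i))) g') T'n.
- by move=> a; rewrite /= g'E g_psi.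
- by move=> y; have [x xE] := g_surj y; exists (rho x); rewrite g'E.
- by move=> i; rewrite g'E gf.
- move=> t'; have [t <-] := rho_surj t'; rewrite g'E => /g_ker[k [c tk]].
  exists k, (fun i => rho (c (lift ord0 i))).
  rewrite -rmorphXn tk rmorph_sum big_ord_recl /= rmorphM.
  have -> : rho (f ord0) = 0 by apply/rho_ker; exists 0%N, 1; rewrite expr1 mul1r.
  by rewrite mulr0 add0r; apply: eq_bigr => i _; rewrite rmorphM.
Qed.

End PerfectedQuotients.

Theorem mainTheorem7 (p : nat) (p_pr : prime p) (R S : comPzRingType)
    (pR : Fp_algebra p R) (pS : Fp_algebra p S)
    (R_perfect : perfect p_pr pR) (S_perfect : perfect p_pr pS)
    (phi : {rmorphism R -> S})
    (phi_pfp : perfectly_finitely_presented p_pr pR phi) :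
  finite_pdim (res_scalars phi).
Proof.
have [n [m [f [h [h_bij h_phi]]]]] := phi_pfp.
pose iotaQ : {rmorphism _ -> _} := to_perfection p_pr (fp_alg_Fp f pR).
pose iotaB : {rmorphism _ -> _} := to_perfection p_pr (Fp_mvpoly pR n).
(* The presentation R[X] -> S, which extends to the perfection of R[X]. *)
pose b : {rmorphism mvpoly n R -> S} := (h \o iotaQ \o ideal_proj f)%FUN.
have [g gE] := perfection_lift (Fp_mvpoly pR n) S_perfect b.
have b_ker x : b x = 0 -> exists k, in_ideal f (x ^+ (p ^ k)).
  rewrite /b /= -(rmorph0 h) => /(bij_inj h_bij)/to_perfection_eq0[k].
  rewrite -rmorphXn -(rmorph0 (ideal_proj f)) => /ideal_projP; rewrite subr0.
  by exists k.
have A_perfect := perfect_perfection p_pr (Fp_mvpoly pR n).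
exists (0 + m.*2)%N; apply: has_pdim_pdim_le.
apply: (has_pdim_perfected_quotients A_perfect S_perfect (psi := mvpoly_perfC p_pr pR n)
  (f := fun i => iotaB (f i)) (g := g)).
- by move=> a; rewrite /= gE; apply: h_phi.
- move=> y; have [h' _ h'K] := h_bij; have [k [z zE]] := colim_in_surj (h' y).
  have [x xE] := ideal_proj_surj z; rewrite -(h'K y) zE xE.
  (* In the k-th copy x stands for a root of exponent p^k. *)
  exists (proot A_perfect k (iotaB x)); apply: (exprp_inj S_perfect (k := k)).
  rewrite -rmorphXn prootK gE -rmorphXn /b /=; congr (h _).
  apply: esym; exact: colim_in_exprp.
- move=> i; rewrite gE /b /=.
  have -> : ideal_proj f (f i) = 0.
    rewrite -(rmorph0 (ideal_proj f)); apply/ideal_projP; rewrite subr0.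
    exists (fun j => (j == i)%:R); rewrite (bigD1 i) //= eqxx mul1r big1 ?addr0 //.
    by move=> j /negbTE ->; rewrite mul0r.
  by rewrite !rmorph0.
- move=> z; have [k [x ->]] := colim_in_surj z => gz0.
  have /b_ker[l [c xl]] : b x = 0.
    have := colim_in_exprp p_pr (Fp_mvpoly pR n) k x => /(congr1 g).
    by rewrite rmorphXn gz0 (exprp0 p_pr pS) gE.
  exists (k + l)%N, (fun i => iotaB (c i)).
  rewrite exprpX colim_in_exprp -rmorphXn xl rmorph_sum.
  by apply: eq_bigr => i _; rewrite rmorphM.
- exact: projective_mvpoly_perf.
Qed.
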